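(* For $m\geq 0$ let $D_m=\sum_{k=0}^{m}\binom{m}{k}\binom{m+k}{k}$ denote the $m$-th central Delannoy number. Then for all integers $n\geq 1$, $$\operatorname{Pf}\big((j-i)D_{i+j-3}\big)_{1\leq i,j\leq 2n}=2^{(n+1)(n-1)}(2n-1)\prod_{k=1}^{n-1}(4k-1).$$
   Context: For a $2n\times 2n$ skew-symmetric matrix $A=(a_{i,j})_{1\le i,j\le 2n}$ over a commutative ring (i.e. $a_{j,i}=-a_{i,j}$ and zero diagonal), the Pfaffian is $$\operatorname{Pf}(A)=\sum \epsilon(\sigma_1,\sigma_2,\dots,\sigma_{2n-1},\sigma_{2n})\,a_{\sigma_1\sigma_2}\cdots a_{\sigma_{2n-1}\sigma_{2n}},$$ where the sum is over all partitions $\{\{\sigma_1,\sigma_2\},\dots,\{\sigma_{2n-1},\sigma_{2n}\}\}$ of $\{1,\dots,2n\}$ into two-element subsets, and $\epsilon(\sigma_1,\dots,\sigma_{2n})$ is the sign of the permutation $i\mapsto\sigma_i$ (each summand is independent of the order of the blocks and of the elements within each block). The diagonal entries of the matrix in the claim are $0$ because of the factor $j-i$; in particular the $(1,1)$ entry is $0$, although $D_{-1}$ is not defined. Empty products equal $1$. *)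

(* Defs.v *)
From HB Require Import structures.
From mathcomp Require Import all_boot all_order all_fingroup all_algebra.

Set Implicit Arguments.
Unset Strict Implicit.
Unset Printing Implicit Defensive.

Import Order.TTheory GRing.Theory Num.Theory.
Local Open Scope ring_scope.

Definition delannoy (m : nat) : nat :=
  (\sum_(0 <= k < m.+1) 'C(m, k) * 'C(m + k, k))%N.

Section Pfaffian.

Variable n : nat.

Lemma pair_fst_proof (i : 'I_n) : (i.*2 < n.*2)%N.
Proof. by rewrite ltn_double. Qed.

Lemma pair_snd_proof (i : 'I_n) : (i.*2.+1 < n.*2)%N.
Proof. by rewrite ltn_Sdouble. Qed.

Definition pair_fst (i : 'I_n) : 'I_(n.*2) := Ordinal (pair_fst_proof i).
Definition pair_snd (i : 'I_n) : 'I_(n.*2) := Ordinal (pair_snd_proof i).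

Definition pair_partition (P : {set {set 'I_(n.*2)}}) : bool :=
  partition P [set: 'I_(n.*2)] && [forall B in P, #|B| == 2%N].

(* The partition {{s 0, s 1}, {s 2, s 3}, ...} listed by the values of s. *)
Definition perm_blocks (s : 'S_(n.*2)) : {set {set 'I_(n.*2)}} :=
  [set [set s (pair_fst i); s (pair_snd i)] | i : 'I_n].

(* Some way of listing P; the default 1 is never reached when P is a
   pair_partition. *)
Definition listing (P : {set {set 'I_(n.*2)}}) : 'S_(n.*2) :=
  odflt 1%g [pick s | perm_blocks s == P].

Definition pf_term (R : comPzRingType) (A : 'M[R]_(n.*2)) (s : 'S_(n.*2)) : R :=
  (-1) ^+ s * \prod_(i < n) A (s (pair_fst i)) (s (pair_snd i)).

(* Meaningful for A skew-symmetric with zero diagonal: pf_term A s then depends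
   only on perm_blocks s, so the choice made by listing is irrelevant. *)
Definition Pf (R : comPzRingType) (A : 'M[R]_(n.*2)) : R :=
  \sum_(P : {set {set 'I_(n.*2)}} | pair_partition P) pf_term A (listing P).

End Pfaffian.

(* Row and column indices of 'M_(n.*2) start at 0, so the 1-based indices of
   the entry at (i, j) are i.+1 and j.+1.  The truncated subtraction matters
   only at i = j = 0, where the first factor vanishes. *)
Definition delannoy_mx (n : nat) : 'M[int]_(n.*2) :=
  \matrix_(i < n.*2, j < n.*2)
    (((j.+1)%:Z - (i.+1)%:Z) * (delannoy (i.+1 + j.+1 - 3))%:Z).

(* Main.v *)
(** The Delannoy number D_m is the m-th moment of the functional L whose weight
    is the arcsine density on the interval between the roots of x^2 - 6x + 1,
    so the matrix is the Gram matrix of the skew form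
    S(f, g) = L(f g' - f' g) in the basis of monomials.  On the interval,
    x = 3 + 2 sqrt 2 cos t; up to scaling the Chebyshev polynomials in cos t
    become polynomials V_m with integer coefficients, and S(V_i, V_j) is
    explicit because V_j' is a multiple of a Chebyshev polynomial of the second
    kind.  Suitable combinations of V_(2l+1) and V_(2l-1) are S-orthogonal to
    V_(2k) for all k < l.  In the resulting basis only the pairing of 2k with
    2k+1 contributes to the Pfaffian, which is then a product of n entries
    divided by the determinant of the base change. *)

Require Import Defs.
From HB Require Import structures.
From mathcomp Require Import all_boot all_order all_fingroup all_algebra.
From mathcomp Require Import ring zify.

Set Implicit Arguments.
Unset Strict Implicit.
Unset Printing Implicit Defensive.

Import Order.TTheory GRing.Theory Num.Theory.
Local Open Scope ring_scope.

(** * Pfaffians *)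

Section PfaffianTheory.

Variable n : nat.
Implicit Types (s t : 'S_(n.*2)) (i j : 'I_n) (P : {set {set 'I_(n.*2)}}).

Lemma pair_fst_inj : injective (@pair_fst n).
Proof. by move=> i j [] /double_inj /val_inj. Qed.

Lemma pair_snd_inj : injective (@pair_snd n).
Proof. by move=> i j [] /double_inj /val_inj. Qed.

Lemma pair_fst_neq_snd i j : pair_fst i != pair_snd j.
Proof.
by apply/eqP=> /(congr1 (odd \o val)) /=; rewrite !odd_double.
Qed.

Lemma pair_idx_subproof (x : 'I_(n.*2)) : (x./2 < n)%N.
Proof. by rewrite ltn_half_double. Qed.

Definition pair_idx (x : 'I_(n.*2)) : 'I_n := Ordinal (pair_idx_subproof x).

Definition pair_elt i (b : bool) := if b then pair_snd i else pair_fst i.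

Lemma pair_eltK x : pair_elt (pair_idx x) (odd x) = x.
Proof.
apply: val_inj; rewrite -[RHS](odd_double_half x) /pair_elt.
by case: (odd x).
Qed.

Lemma pair_idx_elt i b : pair_idx (pair_elt i b) = i.
Proof. by apply: val_inj; case: b => /=; rewrite ?uphalf_double ?doubleK. Qed.

Lemma odd_pair_elt i b : odd (pair_elt i b) = b.
Proof. by case: b => /=; rewrite odd_double. Qed.

Lemma pair_split (x : 'I_(n.*2)) : exists i, x = pair_fst i \/ x = pair_snd i.
Proof.
by exists (pair_idx x); rewrite -{1 3}(pair_eltK x); case: odd; [right|left].
Qed.

Lemma big_pair_elt (R : Type) (idx : R) (op : Monoid.com_law idx)
    (F : 'I_(n.*2) -> R) :
  \big[op/idx]_x F x = \big[op/idx]_(i < n) op (F (pair_fst i)) (F (pair_snd i)).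
Proof.
rewrite (reindex (fun p : 'I_n * bool => pair_elt p.1 p.2)) /=; last first.
  exists (fun x => (pair_idx x, odd x)) => [[i b] _|x _] /=.
    by rewrite pair_idx_elt odd_pair_elt.
  exact: pair_eltK.
rewrite -(pair_big xpredT xpredT (fun i b => F (pair_elt i b))) /=.
by apply: eq_bigr => i _; rewrite big_bool Monoid.mulmC.
Qed.

Definition block s i : {set 'I_(n.*2)} := [set s (pair_fst i); s (pair_snd i)].

Lemma block_inj s : injective (block s).
Proof.
move=> i j /setP/(_ (s (pair_fst i))).
rewrite !inE eqxx /= !(inj_eq perm_inj) (negbTE (pair_fst_neq_snd _ _)) orbF.
by move/esym/eqP/pair_fst_inj.
Qed.

Lemma mem_block s i x : x \in block s i -> (s^-1%g x)./2 = i.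
Proof.
by rewrite !inE => /orP[]/eqP->; rewrite permK /= ?uphalf_double ?doubleK.
Qed.

Lemma block_uniq s i j x : x \in block s i -> x \in block s j -> i = j.
Proof.
move=> /mem_block hi /mem_block hj; apply: val_inj.
exact: etrans (esym hi) hj.
Qed.

Lemma mem_blocks s x : exists i, x \in block s i.
Proof.
have [i hi] := pair_split (s^-1%g x); exists i; rewrite !inE.
by case: hi => /(canRL (permKV s)) <-; rewrite eqxx ?orbT.
Qed.

Lemma pair_partition_blocks s : pair_partition (perm_blocks s).
Proof.
apply/andP; split; last first.
  apply/forall_inP => _ /imsetP[i _ ->].
  by rewrite cards2 (inj_eq perm_inj) pair_fst_neq_snd.
apply/and3P; split.
- apply/eqP/setP=> x; rewrite inE; apply/bigcupP.
  by have [i hi] := mem_blocks s x; exists (block s i) => //; apply: imset_f.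
- apply/trivIsetP => _ _ /imsetP[i _ ->] /imsetP[j _ ->] /eqP neq.
  rewrite -setI_eq0; apply/eqP/setP=> x; rewrite in_setI in_set0.
  apply/negP=> /andP[hi hj]; case: neq.
  by rewrite (block_uniq hi hj).
- apply/imsetP=> -[i _ /setP/(_ (s (pair_fst i)))].
  by rewrite !inE eqxx.
Qed.

Lemma perm_blocks_mul s t :
  perm_blocks (s * t)%g = [set t @: B | B : {set _} in perm_blocks s].
Proof.
rewrite -imset_comp; apply: eq_imset => i /=.
by rewrite imsetU1 imset_set1 !permM.
Qed.

(** Right multiplication by [t] maps the listings of the standard partition onto those of the
    partition of [t], so all nonempty fibres of [perm_blocks] have the same size. *)
Lemma perm_blocks_mul_eq s t :
  (perm_blocks (s * t)%g == perm_blocks t) = (perm_blocks s == perm_blocks 1).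
Proof.
rewrite -{2}[t]mul1g !perm_blocks_mul.
apply/eqP/eqP => [|-> //].
by apply: imset_inj; apply: imset_inj; apply: perm_inj.
Qed.

Lemma pair_partitionP P :
  pair_partition P -> exists s, perm_blocks s = P.
Proof.
case/andP=> partP /forall_inP cardP.
have cP : #|P| = n.
  apply: double_inj; rewrite -[in RHS](card_ord n.*2) -cardsT.
  rewrite (card_partition partP) (eq_bigr (fun=> 2%N)) => [|B /cardP/eqP //].
  by rewrite sum_nat_const muln2.
case/and3P: partP => _ tP _.
(* The listing sends [x] to the element number [odd x] of the block number [x./2], both counted in
   the order of [enum]. *)
pose bl (x : 'I_(n.*2)) := nth set0 (enum P) x./2.
have hbl x : bl x \in P.
  by rewrite -mem_enum mem_nth // -cardE cP ltn_half_double.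
pose f x := nth x (enum (bl x)) (odd x).
have hodd (x : 'I_(n.*2)) : (odd x < size (enum (bl x)))%N.
  by rewrite -cardE (eqP (cardP _ (hbl x))); case: odd.
have hf x : f x \in bl x by rewrite -mem_enum mem_nth.
have finj : injective f.
  move=> x y fxy.
  have blxy : bl x = bl y.
    rewrite -(def_pblock tP (hbl x) (hf x)).
    by apply: def_pblock => //; rewrite fxy.
  have hxy : x./2 = y./2.
    apply/eqP; rewrite -(nth_uniq set0 _ _ (enum_uniq P)) -?cardE ?cP
      ?ltn_half_double //.
    exact/eqP.
  have oxy : odd x = odd y.
    move/eqP: fxy; rewrite /f (set_nth_default x) // blxy nth_uniq ?enum_uniq //.
      by case: (odd x) (odd y) => [] [].
    by rewrite -blxy.
  by apply: val_inj; rewrite /= -[LHS]odd_double_half -[RHS]odd_double_half oxy hxy.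
exists (perm finj); apply/eqP; rewrite eqEcard; apply/andP; split; last first.
  by rewrite (card_imset _ (@block_inj (perm finj))) cardT size_enum_ord cP.
apply/subsetP => _ /imsetP[i _ ->].
suff -> : [set perm finj (pair_fst i); perm finj (pair_snd i)] = bl (pair_fst i).
  exact: hbl.
apply/eqP; rewrite eqEcard (eqP (cardP _ (hbl _))) cards2 (inj_eq perm_inj).
rewrite pair_fst_neq_snd leqnn andbT !permE; apply/subsetP=> x.
have ebl : bl (pair_snd i) = bl (pair_fst i).
  by rewrite /bl /= uphalf_double doubleK.
by rewrite !inE => /orP[]/eqP->; rewrite ?hf // -ebl hf.
Qed.

Lemma listingK P : pair_partition P -> perm_blocks (listing P) = P.
Proof.
case/pair_partitionP=> s sP; rewrite /listing.
by case: pickP => [t /eqP //|/(_ s)]; rewrite sP eqxx.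
Qed.

(** * Independence of a Pfaffian term from the listing *)

Section Term.

Variables (R : comPzRingType) (A : 'M[R]_(n.*2)).
Hypothesis skewA : forall x y, A x y = - A y x.

Lemma pf_term_swap s i :
  pf_term A (tperm (pair_fst i) (pair_snd i) * s)%g = pf_term A s.
Proof.
rewrite /pf_term odd_permM odd_tperm pair_fst_neq_snd signr_addb expr1.
rewrite (bigD1 i) //= [in RHS](bigD1 i) //= !permM tpermL tpermR skewA.
rewrite !mulNr !mulrN mul1r opprK; congr (_ * (_ * _)).
apply: eq_bigr => j ji; rewrite !permM !tpermD //.
- exact: pair_fst_neq_snd.
- by rewrite (inj_eq pair_snd_inj) eq_sym.
- by rewrite (inj_eq pair_fst_inj) eq_sym.
- by rewrite eq_sym pair_fst_neq_snd.
Qed.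

(** This lifts the transposition of [i] and [j] to whole pairs. It is an even permutation, so it
    does not affect the sign of a term. *)
Definition pair_tperm i j : 'S_(n.*2) :=
  (tperm (pair_fst i) (pair_fst j) * tperm (pair_snd i) (pair_snd j))%g.

Lemma pair_tperm_fst i j k :
  pair_tperm i j (pair_fst k) = pair_fst (tperm i j k).
Proof.
rewrite permM -(inj_tperm _ _ _ pair_fst_inj).
by apply: tpermD; rewrite eq_sym pair_fst_neq_snd.
Qed.

Lemma pair_tperm_snd i j k :
  pair_tperm i j (pair_snd k) = pair_snd (tperm i j k).
Proof.
rewrite permM [tperm (pair_fst i) _ _]tpermD ?pair_fst_neq_snd //.
by rewrite -(inj_tperm _ _ _ pair_snd_inj).
Qed.

Lemma pf_term_pair_tperm s i j : pf_term A (pair_tperm i j * s)%g = pf_term A s.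
Proof.
rewrite /pf_term !odd_permM !odd_tperm (inj_eq pair_fst_inj).
rewrite (inj_eq pair_snd_inj) addbb addFb; congr (_ * _).
rewrite [RHS](reindex_inj (@perm_inj _ (tperm i j))).
apply: eq_bigr => k _.
by rewrite !(permM (pair_tperm i j)) pair_tperm_fst pair_tperm_snd.
Qed.

Lemma block_pair_tperm s i j k :
  block (pair_tperm i j * s)%g k = block s (tperm i j k).
Proof. by rewrite /block !(permM (pair_tperm i j)) pair_tperm_fst pair_tperm_snd. Qed.

Lemma pf_term_reorder (p : 'S_n) s :
  exists2 s', pf_term A s' = pf_term A s & forall i, block s' i = block s (p i).
Proof.
have [ts -> _] := prod_tpermP p.
elim: ts s => [|[a b] ts IH] s.
  by exists s => // i; rewrite big_nil perm1.
have [s' hs' bs'] := IH s.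
exists (pair_tperm a b * s')%g; first by rewrite pf_term_pair_tperm.
by move=> i; rewrite block_pair_tperm bs' big_cons permM.
Qed.

(** Such listings differ only by swaps inside blocks. The induction along [l] undoes these one at a
    time; each swap changes both the sign of the permutation and the sign of one entry. *)
Lemma pf_term_block s t : (forall i, block s i = block t i) ->
  pf_term A s = pf_term A t.
Proof.
move=> st.
suff H (l : seq 'I_n) : exists s', [/\ pf_term A s' = pf_term A s,
    forall i, block s' i = block t i
  & forall i, i \in l -> s' (pair_fst i) = t (pair_fst i)].
  have [s' [<- bs' fs']] := H (enum 'I_n).
  have {}fs' i : s' (pair_fst i) = t (pair_fst i) by rewrite fs' ?mem_enum.
  congr pf_term; apply/permP => x; have [i [->|->]//] := pair_split x.
  have : s' (pair_snd i) \in block t i by rewrite -bs' !inE eqxx orbT.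
  rewrite !inE -fs' (inj_eq perm_inj) eq_sym (negbTE (pair_fst_neq_snd _ _)).
  by move/eqP.
elim: l => [|i l [s' [es' bs' fs']]]; first by exists s; split.
have [e|ne] := eqVneq (s' (pair_fst i)) (t (pair_fst i)).
  by exists s'; split => // j; rewrite inE => /predU1P[->|/fs'].
have es : s' (pair_snd i) = t (pair_fst i).
  have : t (pair_fst i) \in block s' i by rewrite bs' !inE eqxx.
  by rewrite !inE eq_sym (negbTE ne) => /eqP.
have hD j : j != i ->
    (tperm (pair_fst i) (pair_snd i) (pair_fst j) = pair_fst j) *
    (tperm (pair_fst i) (pair_snd i) (pair_snd j) = pair_snd j).
  rewrite eq_sym => ij.
  split; apply: tpermD; rewrite ?(inj_eq pair_fst_inj) ?(inj_eq pair_snd_inj) //.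
  - by rewrite eq_sym pair_fst_neq_snd.
  - exact: pair_fst_neq_snd.
exists (tperm (pair_fst i) (pair_snd i) * s')%g; split.
- by rewrite pf_term_swap.
- move=> j; rewrite -bs' /block !permM.
  have [->|ji] := eqVneq j i; first by rewrite tpermL tpermR setUC.
  by rewrite !hD.
- move=> j; rewrite inE permM; have [-> _|ji /= /fs'] := eqVneq j i.
    by rewrite tpermL.
  by rewrite hD.
Qed.

Lemma pf_term_blocks s t :
  perm_blocks s = perm_blocks t -> pf_term A s = pf_term A t.
Proof.
move=> st.
have ex i : exists j, block s j == block t i.
  have : block t i \in perm_blocks s by rewrite st imset_f.
  by case/imsetP=> j _ ->; exists j.
pose f i := xchoose (ex i).
have fP i : block s (f i) = block t i by apply/eqP/(xchooseP (ex i)).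
have finj : injective f.
  by move=> i j /(congr1 (block s)); rewrite !fP => /block_inj.
have [s' <- bs'] := pf_term_reorder (perm finj) s.
by apply: pf_term_block => i; rewrite bs' permE fP.
Qed.

Lemma sum_pf_term_blocks t :
  \sum_(s | perm_blocks s == perm_blocks t) pf_term A s =
  pf_term A t *+ #|[set s : 'S_(n.*2) | perm_blocks s == perm_blocks 1]|.
Proof.
rewrite (eq_bigr (fun=> pf_term A t)) => [|s /eqP]; last exact: pf_term_blocks.
rewrite (reindex_inj (mulIg t)) /= -sumr_const.
by apply: eq_bigl => s; rewrite inE perm_blocks_mul_eq.
Qed.

(** This trades partitions and their chosen listings for the whole symmetric group, where the
    expansion known from determinants applies. The multiplicity is the common fibre size. *)
Lemma sum_pf_term :
  \sum_s pf_term A s =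
  Pf A *+ #|[set s : 'S_(n.*2) | perm_blocks s == perm_blocks 1]|.
Proof.
rewrite (partition_big (@perm_blocks n) (@pair_partition n)) /=; last first.
  by move=> s _; apply: pair_partition_blocks.
rewrite /Pf -sumrMnl; apply: eq_bigr => P hP.
rewrite -sum_pf_term_blocks; apply: eq_bigl => s.
by rewrite listingK.
Qed.

End Term.

(** * Behaviour under congruence *)

Section Congruence.

Variables (R : comPzRingType) (U A : 'M[R]_(n.*2)).

(* As for the multiplicativity of the determinant: expanding the left side over
   all maps f, only the injective ones survive. *)
Lemma sum_pf_term_congr :
  \sum_s pf_term (U *m A *m U^T) s = \det U * \sum_s pf_term A s.
Proof.
pose F := {ffun 'I_(n.*2) -> 'I_(n.*2)}.
pose prodA (f : F) := \prod_i A (f (pair_fst i)) (f (pair_snd i)).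
pose Uf (f : F) : 'M[R]_(n.*2) := \matrix_(x, y) U y (f x).
transitivity (\sum_(f : F) prodA f * \det (Uf f)).
  under [RHS]eq_bigr do rewrite big_distrr.
  rewrite exchange_big; apply: eq_bigr => s _ /=.
  pose G i (p : 'I_(n.*2) * 'I_(n.*2)) :=
    U (s (pair_fst i)) p.1 * A p.1 p.2 * U (s (pair_snd i)) p.2.
  transitivity ((-1) ^+ s * \prod_i \sum_p G i p).
    congr (_ * _); apply: eq_bigr => i _.
    rewrite mxE -(pair_bigA _ (fun a b => G i (a, b))) /= exchange_big /=.
    apply: eq_bigr => b _; rewrite !mxE big_distrl /=.
    by apply: eq_bigr.
  rewrite bigA_distr_bigA big_distrr /=.
  (* Choosing a pair of summation indices for every [i] amounts to choosing one map [f] on all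
     [n.*2] positions. *)
  rewrite (reindex (fun f : F => [ffun i => (f (pair_fst i), f (pair_snd i))])) /=.
    apply: eq_bigr => f _; rewrite mulrCA; congr (_ * _).
    rewrite (big_pair_elt _ (fun x => Uf f x (s x))) -big_split /=.
    by apply: eq_bigr => i _; rewrite ffunE !mxE /G /= mulrCA mulrA.
  exists (fun g : {ffun 'I_n -> 'I_(n.*2) * 'I_(n.*2)} =>
    [ffun x : 'I_(n.*2) => let p := g (pair_idx x) in if odd x then p.2 else p.1]).
    move=> f _; apply/ffunP=> x; rewrite !ffunE /= -[in RHS](pair_eltK x).
    by case: odd.
  move=> g _; apply/ffunP=> i; rewrite !ffunE /= odd_double /=.
  by rewrite (pair_idx_elt i false) (pair_idx_elt i true) -surjective_pairing.
rewrite (bigID (fun f : F => injectiveb f)) /= addrC big1 ?add0r => [|f]; last first.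
  case/injectivePn => i1 [i2 neq eqf].
  by rewrite (determinant_alternate neq) ?mulr0 // => j; rewrite !mxE eqf.
rewrite (reindex (@pval _)) /=; last first.
  pose in_S := insubd (1%g : 'S_(n.*2)).
  by exists in_S => /= f Hf; first apply: val_inj; apply: insubdK.
rewrite big_distrr; apply: eq_big => /= [s | s _]; rewrite ?(valP s) //.
have -> : Uf (pval s) = row_perm s U^T.
  by apply/matrixP=> x y; rewrite !mxE pvalE.
rewrite row_permE det_mulmx det_tr det_perm /pf_term.
rewrite mulrA mulrC; congr (_ * _); rewrite mulrC; congr (_ * _).
by apply: eq_bigr => i _; rewrite !pvalE.
Qed.

End Congruence.

Section Triangular.

Variables (R : comPzRingType) (G : 'M[R]_(n.*2)).
Hypothesis skewG : forall x y, G x y = - G y x.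
Hypothesis evenG : forall i j, G (pair_fst i) (pair_fst j) = 0.
Hypothesis oddG : forall i j, G (pair_snd i) (pair_snd j) = 0.
Hypothesis trigG : forall i j, (i < j)%N -> G (pair_fst i) (pair_snd j) = 0.

(* In a nonzero term 2k is paired with some 2l+1 with l <= k, and induction on
   k excludes l < k. *)
Lemma pf_term_trig_eq0 s :
  perm_blocks s != perm_blocks 1 -> pf_term G s = 0.
Proof.
move=> ne1.
have [/forallP nz|/forallPn[i /negPn/eqP Gi0]] :=
    boolP [forall i, G (s (pair_fst i)) (s (pair_snd i)) != 0]; last first.
  by rewrite /pf_term (bigD1 i) //= Gi0 mul0r mulr0.
have blockE i :
    exists2 j : 'I_n * 'I_n, block s i = [set pair_fst j.1; pair_snd j.2]
    & (j.2 <= j.1)%N.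
  have := nz i; have [a [ha|ha]] := pair_split (s (pair_fst i));
    have [b [hb|hb]] := pair_split (s (pair_snd i));
    rewrite /block ha hb ?evenG ?oddG ?eqxx //.
  - move=> h; exists (a, b) => //=.
    by case: leqP h => // /trigG ->; rewrite eqxx.
  - rewrite skewG oppr_eq0 => h; exists (b, a); first by rewrite setUC.
    by case: leqP h => //= /trigG ->; rewrite eqxx.
have std (k : 'I_n) : exists i, block s i = block 1 k.
  case: k => k; elim/ltn_ind: k => k IH hk.
  have [i hi] := mem_blocks s (pair_fst (Ordinal hk)); exists i.
  have [[a b] /= bi ba] := blockE i.
  have ak : a = Ordinal hk.
    move: hi; rewrite bi !inE (negbTE (pair_fst_neq_snd _ _)) orbF.
    by move/eqP/pair_fst_inj.
  move: ba; rewrite leq_eqVlt => /orP[/eqP/val_inj ba|ba].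
    by rewrite bi /block !perm1 ba ak.
  have ltbk : (b < k)%N by rewrite ak in ba.
  have [i' hi'] := IH b ltbk (ltn_ord b).
  have bE : Ordinal (ltn_ord b) = b by apply: val_inj.
  have ii' : i' = i.
    apply: (@block_uniq s _ _ (pair_snd b)).
      by rewrite hi' !inE !perm1 bE eqxx orbT.
    by rewrite bi !inE eqxx orbT.
  move: hi; rewrite -ii' hi' bE !inE !perm1 (negbTE (pair_fst_neq_snd _ _)) orbF.
  by move/eqP/pair_fst_inj => kb; move: ltbk; rewrite -kb ltnn.
case/negP: ne1; rewrite eq_sym eqEcard; apply/andP; split; last first.
  by rewrite !(card_imset _ (@block_inj _)).
apply/subsetP=> _ /imsetP[k _ ->]; have [i hi] := std k.
by rewrite -[X in X \in _]hi imset_f.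
Qed.

Lemma sum_pf_term_trig :
  \sum_s pf_term G s = (\prod_i G (pair_fst i) (pair_snd i))
    *+ #|[set s : 'S_(n.*2) | perm_blocks s == perm_blocks 1]|.
Proof.
rewrite (bigID (fun s => perm_blocks s == perm_blocks 1)) /= addrC.
rewrite big1 ?add0r; last exact: pf_term_trig_eq0.
rewrite sum_pf_term_blocks //; congr (_ *+ _).
rewrite /pf_term odd_perm1 expr0 mul1r.
by apply: eq_bigr => i _; rewrite !perm1.
Qed.

End Triangular.

End PfaffianTheory.

(** Both sides appear multiplied by the common fibre size, a positive integer that can be cancelled
    in a [numDomainType]. *)
Lemma Pf_congr_trig (R : numDomainType) n (U A : 'M[R]_(n.*2)) :
    let G := U *m A *m U^T in
    (forall x y, A x y = - A y x) ->
    (forall i j : 'I_n, G (pair_fst i) (pair_fst j) = 0) ->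
    (forall i j : 'I_n, G (pair_snd i) (pair_snd j) = 0) ->
    (forall i j : 'I_n, (i < j)%N -> G (pair_fst i) (pair_snd j) = 0) ->
  \det U * Pf A = \prod_(i < n) G (pair_fst i) (pair_snd i).
Proof.
move=> G skewA evenG oddG trigG.
have skewG x y : G x y = - G y x.
  have trA : A^T = - A by apply/matrixP=> a b; rewrite !mxE.
  have trG : G^T = - G by rewrite !trmx_mul trmxK trA mulmxA mulmxN mulNmx.
  by rewrite -[G in LHS]trmxK mxE trG mxE.
have := sum_pf_term_trig skewG evenG oddG trigG.
rewrite sum_pf_term_congr (sum_pf_term skewA) mulrnAr => /eqP.
have c_gt0 : (0 < #|[set s : 'S_(n.*2) | perm_blocks s == perm_blocks 1]|)%N.
  by apply/card_gt0P; exists 1%g; rewrite inE.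
by rewrite eqr_pMn2r // => /eqP.
Qed.

(** * Rescaled Chebyshev polynomials *)

Section Lucas.

Notation y := ('X - 3 : {poly int}).

(* With y = 2 sqrt 2 cos t, lucasV m is 2 * sqrt 2 ^ m * cos (m t) and
   lucasU m is sqrt 2 ^ (m - 1) * sin (m t) / sin t. *)
Fixpoint lucasV m : {poly int} :=
  match m with
  | 0 => 2%R
  | 1 => y
  | (m'.+1 as m1).+1 => y * lucasV m1 - 2 * lucasV m'
  end.

Fixpoint lucasU m : {poly int} :=
  match m with
  | 0 => 0
  | 1 => 1
  | (m'.+1 as m1).+1 => y * lucasU m1 - 2 * lucasU m'
  end.

Lemma lucasVSS m : lucasV m.+2 = y * lucasV m.+1 - 2 * lucasV m.
Proof. by []. Qed.

Lemma lucasUSS m : lucasU m.+2 = y * lucasU m.+1 - 2 * lucasU m.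
Proof. by []. Qed.

Lemma nat_ind2 (Q : nat -> Prop) :
  Q 0%N -> Q 1%N -> (forall m, Q m -> Q m.+1 -> Q m.+2) -> forall m, Q m.
Proof.
move=> h0 h1 hS m; suff [] : Q m /\ Q m.+1 by [].
by elim: m => [|m [hm hm1]]; split => //; apply: hS.
Qed.

Lemma lucasVU m : lucasV m = 2 * lucasU m.+1 - y * lucasU m.
Proof.
elim/nat_ind2: m => [||m h h1]; [by rewrite /=; ring|by rewrite /=; ring|].
rewrite lucasVSS h h1 !lucasUSS; ring.
Qed.

Lemma lucasVE m : lucasV m.+1 = lucasU m.+2 - 2 * lucasU m.
Proof. rewrite lucasVU !lucasUSS; ring. Qed.

(** This is 2 cos a sin b = sin (a + b) + sin (b - a) with a = i t and b = (i + d) t; the next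
    product formula is its companion for 2 sin a cos b. *)
Lemma lucasVU_mul i d :
  lucasV i * lucasU (i + d) = lucasU (i + i + d) + 2 ^+ i * lucasU d.
Proof.
elim/nat_ind2: i d => [||i h h1] d.
- by rewrite !add0n expr0 /=; ring.
- by rewrite !add1n addSn add1n expr1 lucasUSS /=; ring.
- have := h1 d.+1; have := h d.+2.
  rewrite !(addnS, addSn) !exprS lucasVSS mulrBl -!mulrA => -> ->.
  rewrite [lucasU d.+2]lucasUSS [lucasU (i + i + d).+4]lucasUSS; ring.
Qed.

Lemma lucasUV_mul i d :
  lucasU i * lucasV (i + d) = lucasU (i + i + d) - 2 ^+ i * lucasU d.
Proof.
elim/nat_ind2: i d => [||i h h1] d.
- by rewrite !add0n expr0 /=; ring.
- by rewrite !add1n addSn add1n expr1 lucasUSS lucasVU lucasUSS /=; ring.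
- have := h1 d.+1; have := h d.+2.
  rewrite !(addnS, addSn) !exprS [lucasU i.+2]lucasUSS mulrBl -!mulrA => -> ->.
  rewrite [lucasU d.+2]lucasUSS [lucasU (i + i + d).+4]lucasUSS; ring.
Qed.

Lemma lucasV0 : lucasV 0 = 2.
Proof. by []. Qed.

Lemma lucasV1 : lucasV 1 = y.
Proof. by []. Qed.

Lemma lucasU0 : lucasU 0 = 0.
Proof. by []. Qed.

Lemma lucasU1 : lucasU 1 = 1.
Proof. by []. Qed.

Lemma deriv_y : y^`() = 1.
Proof. by rewrite derivB derivX -polyC_natr derivC subr0. Qed.

Lemma deriv_lucasV m : (lucasV m)^`() = m%:R * lucasU m.
Proof.
elim/nat_ind2: m => [||m h h1].
- by rewrite /= -polyC_natr derivC mul0r.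
- by rewrite /= deriv_y mulr1.
- rewrite lucasVSS derivB !derivM -[2]polyC_natr derivC polyC_natr deriv_y.
  rewrite h h1 lucasVE !lucasUSS.
  ring.
Qed.

(** With y = 2 sqrt 2 cos t, this is the t-derivative of [lucasU m] * sin t = sqrt 2 ^ (m - 1) * sin
    (m t), since y^2 - 8 = - 8 sin^2 t. *)
Lemma deriv_lucasU m :
  (y ^+ 2 - 8) * (lucasU m)^`() + y * lucasU m = m%:R * lucasV m.
Proof.
suff -> : (y ^+ 2 - 8) * (lucasU m)^`() = m%:R * lucasV m - y * lucasU m.
  by rewrite subrK.
elim/nat_ind2: m => [||m h h1].
- by rewrite /= linear0; ring.
- by rewrite /= -polyC1 derivC; ring.
- rewrite lucasUSS derivB !derivM -[2]polyC_natr derivC polyC_natr deriv_y.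
  rewrite mul0r add0r mul1r.
  rewrite mulrBr mulrDr [_ * (y * _)]mulrCA [_ * (2 * _)]mulrCA h h1 lucasVSS.
  rewrite !lucasVU !lucasUSS; ring.
Qed.

End Lucas.

Arguments lucasV m : simpl never.
Arguments lucasU m : simpl never.

(** * The recurrence of the Delannoy numbers *)

Section DelannoyRec.

Definition delannoy_term m k := ('C(m, k) * 'C(m + k, k))%N.

Lemma ffact_addn a p q : (a ^_ (p + q) = a ^_ p * (a - p) ^_ q)%N.
Proof.
elim: q => [|q IH]; first by rewrite addn0 ffactn0 muln1.
by rewrite addnS !ffactnSr IH subnDA mulnA.
Qed.

(** Clearing the denominators turns the terms of the recurrence into multiples of a single falling
    factorial. *)
Lemma delannoy_term_fact m k :
  (delannoy_term m k * k`! ^ 2 = (m + k) ^_ (k + k))%N.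
Proof.
rewrite ffact_addn addnK -!bin_ffact /delannoy_term; ring.
Qed.

(* This is the coefficient of z^(j+1) in the three-term recurrence of the
   Legendre polynomials P_m(1 + 2z); at z = 1 it sums to that of D_m = P_m(3). *)
Lemma delannoy_term_rec m j :
  (m.+2%:Z * (delannoy_term m.+2 j.+1)%:Z + m.+1%:Z * (delannoy_term m j.+1)%:Z =
   (m.*2.+3)%:Z * ((delannoy_term m.+1 j.+1)%:Z + 2 * (delannoy_term m.+1 j)%:Z)).
Proof.
have nz : ((j.+1)`! ^ 2)%:Z != 0 by rewrite eqz_nat -lt0n expn_gt0 fact_gt0.
apply: (mulIf nz); set f := (j.+1)`!.
pose Y := ((m.+1 + j) ^_ (j + j))%N.
have E0 : (delannoy_term m j.+1)%:Z * (f ^ 2)%:Z =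
    Y%:Z * (m%:Z + 1 - j%:Z) * (m%:Z - j%:Z).
  rewrite -PoszM delannoy_term_fact.
  have -> : (m + j.+1 = m.+1 + j)%N by lia.
  have -> : (j.+1 + j.+1 = (j + j).+2)%N by lia.
  rewrite 2!ffactnSr -/Y.
  (* Subtraction is truncated in [nat] but not in [int]. At j = m + 1 the factor m + 1 - j vanishes
     on both sides, and beyond that [Y] itself is 0. *)
  case: (leqP j m) => hj; first by rewrite !PoszM -!subzn; lia.
  have [hj1|hj1] := eqVneq j m.+1.
    have -> : (m.+1 + j - (j + j) = 0)%N by lia.
    by rewrite muln0 mul0n hj1 intS; ring.
  by rewrite /Y ffact_small ?mul0n //; lia.
have E1 : (delannoy_term m.+1 j.+1)%:Z * (f ^ 2)%:Z =
    (m%:Z + j%:Z + 2) * Y%:Z * (m%:Z + 1 - j%:Z).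
  rewrite -PoszM delannoy_term_fact.
  rewrite !addnS !addSn ffactSS ffactnSr -addSn -/Y.
  case: (leqP j m.+1) => hj; first by nia.
  by rewrite /Y ffact_small ?mul0n //; lia.
have E2 : (delannoy_term m.+2 j.+1)%:Z * (f ^ 2)%:Z =
    (m%:Z + j%:Z + 3) * (m%:Z + j%:Z + 2) * Y%:Z.
  rewrite -PoszM delannoy_term_fact.
  rewrite !addnS !addSn !ffactSS -addSn -/Y; nia.
have E3 : (delannoy_term m.+1 j)%:Z * (f ^ 2)%:Z = (j%:Z + 1) ^+ 2 * Y%:Z.
  have := delannoy_term_fact m.+1 j; rewrite -/Y /f factS expnMn => <-; lia.
rewrite mulrDl -!mulrA E2 E0 [X in _ = _ * X]mulrDl E1 -[2 * _ * _]mulrA E3.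
have -> : (m.*2.+3)%:Z = 2 * m%:Z + 3 by lia.
have -> : m.+2%:Z = m%:Z + 2 by lia.
have -> : m.+1%:Z = m%:Z + 1 by lia.
ring.
Qed.

Lemma delannoyE m N : (m < N)%N ->
  (delannoy m)%:Z = \sum_(k < N) (delannoy_term m k)%:Z.
Proof.
move=> mN; rewrite -(big_mkord xpredT (fun k => (delannoy_term m k)%:Z)).
rewrite (big_cat_nat (n := m.+1)) //= [X in _ + X]big_nat.
rewrite [X in _ + X]big1 => [|k]; last first.
  by move=> hk; rewrite /delannoy_term bin_small //; case/andP: hk.
by rewrite addr0 /delannoy (big_morph _ PoszD (erefl _)).
Qed.

Lemma delannoy_rec m :
  m.+2%:Z * (delannoy m.+2)%:Z + m.+1%:Z * (delannoy m)%:Z =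
  3 * (m.*2.+3)%:Z * (delannoy m.+1)%:Z.
Proof.
rewrite (@delannoyE m.+2 m.+3) // (@delannoyE m m.+3); last by lia.
have -> : 3 * (m.*2.+3)%:Z * (delannoy m.+1)%:Z =
  (m.*2.+3)%:Z * (delannoy m.+1)%:Z + (m.*2.+3)%:Z * (2 * (delannoy m.+1)%:Z) by ring.
(* The second copy has a shorter range because its term [j] is matched with the terms [j.+1] of the
   other sums; their terms at 0 are compared separately. *)
rewrite {1}(@delannoyE m.+1 m.+3) // (@delannoyE m.+1 m.+2) //.
rewrite !(big_ord_recl m.+2) !mulrDr -!addrA [X in _ + X]addrCA !addrA -addrA.
rewrite [in RHS]addrAC -[RHS]addrA; congr (_ + _).
  by rewrite /delannoy_term !bin0; lia.
rewrite !mulr_sumr -!big_split; apply: eq_bigr => j _ /=.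
by rewrite delannoy_term_rec; ring.
Qed.

End DelannoyRec.

(** * The skew form *)

Section DelannoyForm.

Notation y := ('X - 3 : {poly int}).

Definition delannoy_form (p : {poly int}) : int :=
  \sum_(i < size p) p`_i * (delannoy i)%:Z.

Lemma delannoy_formE N (p : {poly int}) : (size p <= N)%N ->
  delannoy_form p = \sum_(i < N) p`_i * (delannoy i)%:Z.
Proof.
move=> hN; rewrite /delannoy_form.
rewrite (big_ord_widen N (fun i => p`_i * (delannoy i)%:Z)) // big_mkcond /=.
by apply: eq_bigr => i _; case: ltnP => // /(nth_default 0) ->; rewrite mul0r.
Qed.

Lemma delannoy_form_is_scalar : scalar delannoy_form.
Proof.
move=> a p q; set N := maxn (size p) (size q).
have hp : (size p <= N)%N by rewrite leq_maxl.
have hq : (size q <= N)%N by rewrite leq_maxr.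
have hpq : (size (a *: p + q)%R <= N)%N.
  by apply/leq_sizeP => k hk; rewrite coefD coefZ !nth_default ?mulr0 ?addr0 //;
    [apply: leq_trans hk|apply: leq_trans hk].
rewrite !(@delannoy_formE N) // mulr_sumr -big_split; apply: eq_bigr => i _ /=.
by rewrite coefD coefZ mulrDl mulrA.
Qed.

HB.instance Definition _ :=
  GRing.isLinear.Build int {poly int} int *%R delannoy_form
    delannoy_form_is_scalar.

Lemma delannoy_formD p q :
  delannoy_form (p + q) = delannoy_form p + delannoy_form q.
Proof. exact: linearD. Qed.

Lemma delannoy_formB p q :
  delannoy_form (p - q) = delannoy_form p - delannoy_form q.
Proof. exact: linearB. Qed.

Lemma delannoy_formZ a p : delannoy_form (a *: p) = a * delannoy_form p.
Proof. exact: linearZ. Qed.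

Lemma delannoy_formXn m : delannoy_form 'X^m = (delannoy m)%:Z.
Proof.
rewrite /delannoy_form size_polyXn big_ord_recr /= big1 => [|i _].
  by rewrite add0r coefXn eqxx mul1r.
by rewrite coefXn ltn_eqF ?mul0r // ltn_ord.
Qed.

Lemma deriv_sum (R : nzRingType) N (F : 'I_N -> {poly R}) :
  (\sum_i F i)^`() = \sum_i (F i)^`().
Proof. exact: linear_sum. Qed.

(* Integration by parts: the weight w = (8 - y^2)^(-1/2) satisfies
   ((y^2 - 8) w)' = y w. *)
Lemma delannoy_form_ibp f :
  delannoy_form ((y ^+ 2 - 8) * f^`() + y * f) = 0.
Proof.
pose E (g : {poly int}) := (y ^+ 2 - 8) * g^`() + y * g.
rewrite -/(E f) -[f]coefK poly_def.
have -> (N : nat) (c : nat -> int) :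
    E (\sum_(i < N) c i *: 'X^i) = \sum_(i < N) c i *: E 'X^i.
  rewrite /E deriv_sum !mulr_sumr -big_split; apply: eq_bigr => i _ /=.
  by rewrite derivZ -!scalerAr scalerDr.
rewrite linear_sum big1 // => i _; rewrite /= delannoy_formZ.
suff -> : delannoy_form (E 'X^i) = 0 by rewrite mulr0.
(* For the constant monomial the claim is D_1 = 3 D_0, which [delannoy_rec] does not cover. *)
case: (nat_of_ord i) => [|m].
  have -> : E 'X^0 = 'X^1 - 3 *: 'X^0.
    by rewrite /E expr0 -polyC1 derivC mulr0 add0r scale_polyC; ring.
  rewrite delannoy_formB delannoy_formZ !delannoy_formXn /delannoy !big_nat_recr //=.
  by rewrite !big_geq.
(* Since y^2 - 8 = X^2 - 6 X + 1, the coefficients are exactly those of [delannoy_rec]. *)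
have -> : E 'X^(m.+1) =
    m.+2%:Z *: 'X^(m.+2) - (3 * m.*2.+3%:Z) *: 'X^(m.+1) + m.+1%:Z *: 'X^m.
  rewrite /E derivXn -!mul_polyC -mulr_natl !exprS /=.
  rewrite -mul2n.
  ring.
rewrite delannoy_formD delannoy_formB !delannoy_formZ !delannoy_formXn.
rewrite -delannoy_rec; ring.
Qed.

(* Chebyshev's differential equation puts m * lucasV m in the form annihilated
   by delannoy_form_ibp. *)
Lemma delannoy_form_lucasV m : delannoy_form (lucasV m.+1) = 0.
Proof.
have := delannoy_form_ibp (lucasU m.+1); rewrite deriv_lucasU.
rewrite -[m.+1%:R]polyC_natr mul_polyC delannoy_formZ natz => /eqP.
by rewrite mulf_eq0 => /orP[//|/eqP].
Qed.

Lemma delannoy_form_lucasUSS m :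
  delannoy_form (lucasU m.+2) = 2 * delannoy_form (lucasU m).
Proof.
have := delannoy_form_lucasV m; rewrite lucasVE delannoy_formB.
by rewrite -[2]polyC_natr mul_polyC delannoy_formZ => /eqP; rewrite subr_eq0 => /eqP.
Qed.

Lemma delannoy_form_lucasU_even k : delannoy_form (lucasU k.*2) = 0.
Proof.
elim: k => [|k IH]; first by rewrite lucasU0 linear0.
by rewrite doubleS delannoy_form_lucasUSS IH mulr0.
Qed.

Lemma delannoy_form_lucasU_odd k : delannoy_form (lucasU k.*2.+1) = 2 ^+ k.
Proof.
elim: k => [|k IH].
  by rewrite lucasU1 -(expr0 'X) delannoy_formXn /delannoy big_nat1.
by rewrite doubleS delannoy_form_lucasUSS IH exprS.
Qed.

(** * Values of the skew form on monomials and on the rescaled Chebyshev polynomials *)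

Definition skew_form (f g : {poly int}) : int :=
  delannoy_form (f * g^`() - f^`() * g).

Lemma skew_formC f g : skew_form f g = - skew_form g f.
Proof. by rewrite /skew_form -linearN opprB mulrC [f^`() * _]mulrC. Qed.

Lemma skew_form_suml N (c : nat -> int) (h : nat -> {poly int}) g :
  skew_form (\sum_(i < N) c i *: h i) g = \sum_(i < N) c i * skew_form (h i) g.
Proof.
rewrite /skew_form deriv_sum !mulr_suml -sumrB linear_sum.
apply: eq_bigr => i _.
by rewrite /= derivZ -!scalerAl -scalerBr delannoy_formZ.
Qed.

Lemma skew_form_sumr N (c : nat -> int) (h : nat -> {poly int}) f :
  skew_form f (\sum_(i < N) c i *: h i) = \sum_(i < N) c i * skew_form f (h i).
Proof.
rewrite skew_formC skew_form_suml -sumrN; apply: eq_bigr => i _.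
by rewrite -mulrN -skew_formC.
Qed.

Lemma skew_formBr f a b g h :
  skew_form f (a *: g - b *: h) = a * skew_form f g - b * skew_form f h.
Proof.
have -> : a *: g - b *: h = \sum_(i < 2) nth 0 [:: a; - b] i *: nth 0 [:: g; h] i.
  by rewrite !big_ord_recl big_ord0 addr0 /= scaleNr.
by rewrite skew_form_sumr !big_ord_recl big_ord0 addr0 /= mulNr.
Qed.

(** The left side is (b - a) L(X^(a + b - 1)), so [delannoy_mx] is the Gram matrix of the monomials.
    At a = b = 0 the factor b - a hides the truncated index. *)
Lemma skew_formXn a b :
  skew_form 'X^a 'X^b =
  ((b.+1)%:Z - (a.+1)%:Z) * (delannoy (a.+1 + b.+1 - 3))%:Z.
Proof.
rewrite /skew_form !derivXn.
case: a b => [|a] [|b] /=.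
- by rewrite !mulr0n !(mulr0, mul0r) subr0 linear0.
- rewrite mulr0n mul0r subr0 expr0 mul1r -scaler_nat delannoy_formZ delannoy_formXn.
  by congr (_ * (delannoy _)%:Z); lia.
- rewrite mulr0n mulr0 add0r expr0 mulr1 -scaler_nat -scaleNr.
  rewrite delannoy_formZ delannoy_formXn.
  by congr (_ * (delannoy _)%:Z); lia.
- rewrite -!scaler_nat -scalerAr -scalerAl -!exprD addnS -addSn -scalerBl.
  rewrite delannoy_formZ delannoy_formXn.
  by congr (_ * (delannoy _)%:Z); lia.
Qed.

Lemma skew_form_coef N (f g : {poly int}) : (size f <= N)%N -> (size g <= N)%N ->
  skew_form f g =
  \sum_(a < N) \sum_(b < N) f`_a * g`_b * skew_form 'X^a 'X^b.
Proof.
have polyE (p : {poly int}) : (size p <= N)%N -> p = \sum_(i < N) p`_i *: 'X^i.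
  move=> hp; rewrite -poly_def; apply/polyP => k; rewrite coef_poly.
  by case: ltnP => // hk; rewrite nth_default // (leq_trans hp).
move=> hf hg; rewrite [in LHS](polyE f hf) (skew_form_suml _ (nth 0 f)).
apply: eq_bigr => a _; rewrite [in LHS](polyE g hg) (skew_form_sumr _ (nth 0 g)).
by rewrite mulr_sumr; apply: eq_bigr => b _; rewrite mulrA.
Qed.

(** By the product formulas the argument of L is a combination of [lucasU] at the even indices 2i +
    2e and 2e, where L vanishes. *)
Lemma skew_form_lucasV_even i e : skew_form (lucasV i) (lucasV (i + e.*2)) = 0.
Proof.
rewrite /skew_form !deriv_lucasV mulrCA -mulrA lucasVU_mul lucasUV_mul.
rewrite -[i%:R]polyC_natr -[(i + _)%:R]polyC_natr -[2]polyC_natr -polyC_exp.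
rewrite !mul_polyC delannoy_formB !delannoy_formZ delannoy_formD delannoy_formB.
rewrite !delannoy_formZ.
by rewrite addnn -doubleD !delannoy_form_lucasU_even !(mulr0, addr0, subr0).
Qed.

(** Both terms of each product formula now have the image 2^(i + e) under L: they add up in V_i U_j
    and cancel in U_i V_j, where j = i + 2e + 1. *)
Lemma skew_form_lucasV_odd i e :
  skew_form (lucasV i) (lucasV (i + e.*2.+1)) =
  (i + e.*2.+1)%:R * 2 ^+ (i + e).+1.
Proof.
rewrite /skew_form !deriv_lucasV mulrCA -mulrA lucasVU_mul lucasUV_mul.
rewrite -[i%:R]polyC_natr -[(i + _)%:R]polyC_natr -[2]polyC_natr -polyC_exp.
rewrite !mul_polyC delannoy_formB !delannoy_formZ delannoy_formD delannoy_formB.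
rewrite !delannoy_formZ.
rewrite addnn !addnS -doubleD !delannoy_form_lucasU_odd exprS exprD.
rewrite !natz; ring.
Qed.

(* At m = 1 the second term is absent: its coefficient is 0. *)
Definition skew_poly m : {poly int} :=
  if odd m then
    (m%:Z - 2) *: lucasV m - (if m is m'.+2 then 2 * m%:Z else 0) *: lucasV m.-2
  else lucasV m.

Lemma skew_polyE k : skew_poly k.*2 = lucasV k.*2.
Proof. by rewrite /skew_poly odd_double. Qed.

Lemma skew_polyO k : skew_poly k.*2.+1 =
  (k.*2.+1%:Z - 2) *: lucasV k.*2.+1
  - (if k is 0 then 0 else 2 * k.*2.+1%:Z) *: lucasV (k.-1).*2.+1.
Proof.
rewrite /skew_poly oddS odd_double.
by case: k => [|k] //=; rewrite !scale0r.
Qed.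

Lemma skew_form_evens k l : skew_form (skew_poly k.*2) (skew_poly l.*2) = 0.
Proof.
rewrite !skew_polyE; wlog kl : k l / (k <= l)%N.
  move=> H; case/orP: (leq_total k l) => /H // e.
  by rewrite skew_formC e oppr0.
by rewrite -(subnKC kl) doubleD skew_form_lucasV_even.
Qed.

Lemma skew_form_lucasV_odds k l :
  skew_form (lucasV k.*2.+1) (lucasV l.*2.+1) = 0.
Proof.
wlog kl : k l / (k <= l)%N.
  move=> H; case/orP: (leq_total k l) => /H // e.
  by rewrite skew_formC e oppr0.
by rewrite -(subnKC kl) doubleD -addSn skew_form_lucasV_even.
Qed.

Lemma skew_form_odds k l :
  skew_form (skew_poly k.*2.+1) (skew_poly l.*2.+1) = 0.
Proof.
by rewrite !skew_polyO skew_formBr; do 2!rewrite skew_formC skew_formBr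
  !skew_form_lucasV_odds !(mulr0, subr0, oppr0).
Qed.

(** For m = 2l + 1 and m = 2l - 1 alike, S(V_(2k), V_m) = m 2^(k + (m + 1) / 2). The ratio of the
    two values does not involve k, so a single combination is orthogonal for all k < l. *)
Lemma skew_form_lt k l : (k < l)%N ->
  skew_form (skew_poly k.*2) (skew_poly l.*2.+1) = 0.
Proof.
case: l => [//|l]; rewrite ltnS => kl.
rewrite skew_polyE skew_polyO skew_formBr /=.
have -> : (l.+1.*2.+1 = k.*2 + (l - k).+1.*2.+1)%N by lia.
rewrite (_ : l.*2.+1 = k.*2 + (l - k).*2.+1)%N; last by lia.
rewrite !skew_form_lucasV_odd !natz.
rewrite (_ : (k.*2 + (l - k).+1).+1 = (k.*2 + (l - k)).+2)%N; last by lia.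
rewrite !exprS.
have -> : (k.*2 + (l - k).*2.+1)%:Z = 2 * l%:Z + 1 by lia.
have -> : (k.*2 + ((l - k).+1).*2.+1)%:Z = 2 * l%:Z + 3 by lia.
ring.
Qed.

(** Here V_(2k-1) has a smaller index than V_(2k), so the second pairing changes sign and the two
    contributions add up: (2k - 1) + 2k = 4k - 1. *)
Lemma skew_form_diag k :
  skew_form (skew_poly k.*2) (skew_poly k.*2.+1) =
  2 ^+ k.*2.+1 * (2 * k%:Z + 1) * (4 * k%:Z - 1).
Proof.
rewrite skew_polyE skew_polyO skew_formBr.
rewrite -[in X in X - _]addn1 (skew_form_lucasV_odd _ 0) !addn0 addn1 natz.
case: k => [|k]; first by rewrite mul0r subr0.
rewrite skew_formC (_ : k.+1.*2 = k.*2.+1 + 0.*2.+1)%N; last by lia.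
rewrite skew_form_lucasV_odd !addn0 [in RHS]exprS addn1 !exprS.
have -> : k.*2.+3%:Z = 2 * k%:Z + 3 by lia.
have -> : k.*2.+2%:R = 2 * k%:Z + 2 by rewrite natz; lia.
have -> : k.+1%:Z = k%:Z + 1 by lia.
ring.
Qed.

(** * Leading coefficients and the determinant of the base change *)

Lemma lucasV_coef_gt m k : (m < k)%N -> (lucasV m)`_k = 0.
Proof.
elim/nat_ind2: m k => [||m h h1] [|k] // hk.
- by rewrite lucasV0 -polyC_natr coefC.
- by rewrite lucasV1 coefB coefX -polyC_natr coefC; case: k hk.
- rewrite lucasVSS mulrBl !mulr_natl !coefB coefXM !coefMn /=.
  by rewrite h1 // h1 ?h ?mul0rn ?subr0 //; lia.
Qed.

Lemma lucasV_coefS m : (lucasV m.+1)`_m.+1 = 1.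
Proof.
elim: m => [|m IH]; first by rewrite lucasV1 coefB coefX -polyC_natr coefC.
rewrite lucasVSS mulrBl !mulr_natl !coefB coefXM !coefMn /= IH.
by rewrite !lucasV_coef_gt ?mul0rn ?subr0.
Qed.

Lemma skew_poly_coef_gt m k : (m < k)%N -> (skew_poly m)`_k = 0.
Proof.
move=> mk; rewrite /skew_poly; case: ifP => _; last exact: lucasV_coef_gt.
by rewrite coefB !coefZ !lucasV_coef_gt ?mulr0 ?subr0 //; lia.
Qed.

Lemma skew_poly_coef_even k :
  (skew_poly k.*2)`_k.*2 = if k is 0 then 2 else 1.
Proof.
rewrite skew_polyE; case: k => [|k]; first by rewrite lucasV0 -polyC_natr coefC.
by rewrite doubleS lucasV_coefS.
Qed.

Lemma skew_poly_coef_odd k : (skew_poly k.*2.+1)`_k.*2.+1 = 2 * k%:Z - 1.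
Proof.
rewrite skew_polyO coefB !coefZ lucasV_coefS mulr1.
case: k => [|k]; first by rewrite mul0r subr0.
rewrite lucasV_coef_gt ?mulr0 ?subr0; lia.
Qed.

End DelannoyForm.

Definition skew_poly_mx n : 'M[int]_(n.*2) := \matrix_(x, k) (skew_poly x)`_k.

Lemma skew_poly_mx_congr n x y :
  (skew_poly_mx n *m delannoy_mx n *m (skew_poly_mx n)^T) x y =
  skew_form (skew_poly x) (skew_poly y).
Proof.
have hsize (z : 'I_(n.*2)) : (size (skew_poly z) <= n.*2)%N.
  by apply/leq_sizeP => k hk; apply: skew_poly_coef_gt; apply: leq_trans hk.
rewrite (@skew_form_coef n.*2) // mxE exchange_big; apply: eq_bigr => b _ /=.
rewrite !mxE mulr_suml; apply: eq_bigr => a _.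
by rewrite !mxE skew_formXn mulrAC.
Qed.

Lemma det_skew_poly_mx n :
  \det (skew_poly_mx n.+1) = - 2 * \prod_(k < n) (2 * k%:Z + 1).
Proof.
rewrite det_trig; last first.
  by apply/is_trig_mxP => x k xk; rewrite mxE skew_poly_coef_gt.
(* The first pair has leading coefficients 2 and -1; the pair number k + 1 has 1 and 2k + 1. *)
rewrite big_pair_elt big_ord_recl; congr (_ * _).
  by rewrite !mxE /= (skew_poly_coef_even 0) (skew_poly_coef_odd 0).
apply: eq_bigr => k _; rewrite !mxE /=.
by rewrite (skew_poly_coef_even k.+1) (skew_poly_coef_odd k.+1); lia.
Qed.

(** The determinant of the base change is split off: it absorbs the factors 2k + 1 with k < n and
    the sign of 4k - 1 at k = 0. The powers of 2 multiply to 2^((n + 1)^2), and (n + 1)^2 = 1 + (n +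
    2) n. *)
Lemma prod_skew_form_diag n :
  \prod_(k < n.+1) (2 ^+ k.*2.+1 * (2 * k%:Z + 1) * (4 * k%:Z - 1)) =
  - 2 * \prod_(k < n) (2 * k%:Z + 1) *
  (2 ^+ (n.+2 * n) * (2 * n%:Z + 1) * \prod_(1 <= k < n.+1) (4 * k%:Z - 1)).
Proof.
elim: n => [|n IH].
  by rewrite big_ord_recr !big_ord0 big_geq.
rewrite big_ord_recr /= IH [in RHS]big_ord_recr [in RHS]big_nat_recr //=.
have -> : (n.+3 * n.+1 = n.+2 * n + n.+1.*2.+1)%N by lia.
have -> : n.+1%:Z = n%:Z + 1 by lia.
by rewrite exprD; ring.
Qed.

Theorem theorem3 (n : nat) (hn : (1 <= n)%N) :
  Pf (delannoy_mx n) =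
  2 ^+ ((n + 1) * (n - 1)) * (2 * n%:Z - 1) * \prod_(1 <= k < n) (4 * k%:Z - 1).
Proof.
case: n hn => [//|n] _.
have : \det (skew_poly_mx n.+1) * Pf (delannoy_mx n.+1) =
    \prod_(k < n.+1) (2 ^+ k.*2.+1 * (2 * k%:Z + 1) * (4 * k%:Z - 1)).
  rewrite Pf_congr_trig => [|x y|i j|i j|i j ij].
  - by apply: eq_bigr => k _; rewrite skew_poly_mx_congr skew_form_diag.
  - by rewrite !mxE addnC -mulNr opprB.
  - by rewrite skew_poly_mx_congr skew_form_evens.
  - by rewrite skew_poly_mx_congr skew_form_odds.
  - by rewrite skew_poly_mx_congr skew_form_lt.
rewrite prod_skew_form_diag -det_skew_poly_mx => /mulfI ->; last first.
  rewrite det_skew_poly_mx mulf_neq0 //.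
  by apply/prodf_neq0 => k _; lia.
by rewrite addn1 subn1 /=; congr (_ * _ * _); lia.
Qed.
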